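(* Let $\mathcal Q$ be a finite, prospectively specified pool of h-, p-, and operator-derived blocks, and for $S\subset\mathcal Q$ let $$\mathcal F(S)=\|r_0\|_Y^2-\min_{v\in V_0+\sum_{q\in S}\mathcal C_q}\|g-Tv\|_Y^2 .$$ Fix an integer $k\ge1$. Suppose that, after quotienting exact redundancy, every conditional joint Schur Gram operator formed from at most $2k$ blocks has lower bound $A_{2k}>0$, while every conditional one-block Schur Gram operator has upper bound $B_1<\infty$. Set $\gamma=A_{2k}/B_1\le1$. Starting with $S_0=\varnothing$, at step $m$ choose the block $q_m$ maximizing its computed marginal gain $\widetilde G_m(q)$, set $S_{m+1}=S_m\cup\{q_m\}$ and refit in the enlarged space, and assume that the perturbation-safe ranking estimate (stated with its hypotheses and its explicit margin $\Xi_m(q)$ in the context) supplies $$|G_m(q)-\widetilde G_m(q)|\le\Xi_m(q),$$ where $G_m(q)=\mathcal F(S_m\cup\{q\})-\mathcal F(S_m)$ is the exact marginal gain. Define $\delta_m=2\max_{q\notin S_m}\Xi_m(q)$ and $\rho=1-\gamma/k$. Then, for $0\le m\le k$ and every comparator $O\subset\mathcal Q$ with $|O|\le k$, $$\mathcal F(S_m)\ge(1-\rho^m)\mathcal F(O)-\sum_{j=0}^{m-1}\rho^{m-1-j}\delta_j .$$ In particular, after $k$ accepted blocks, $$\mathcal F(S_k)\ge(1-e^{-\gamma})\mathcal F(O)-\sum_{j=0}^{k-1}\rho^{k-1-j}\delta_j .$$ Equivalently, the squared residual of the computed mixed refinement is at most the oracle residual plus $e^{-\gamma}\mathcal F(O)$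 and the displayed, fully computable inexactness penalty: $$\min_{v\in V_0+\sum_{q\in S_k}\mathcal C_q}\|g-Tv\|_Y^2\le\min_{v\in V_0+\sum_{q\in O}\mathcal C_q}\|g-Tv\|_Y^2+e^{-\gamma}\mathcal F(O)+\sum_{j=0}^{k-1}\rho^{k-1-j}\delta_j .$$
   Context: $X,Y$ are Hilbert spaces (trial and test), $T:X\to Y$ is a bounded linear operator (the trial-to-test operator), $g\in Y$, $V_0\subset X$ is a finite-dimensional initial trial space, and $r_0=g-Tu_0$ with $u_0$ a minimizer of $\|g-Tv\|_Y$ over $V_0$. Each block $q\in\mathcal Q$ is a linear map $C_q:E_q\to X$ from a finite-dimensional Hilbert coefficient space, with range $\mathcal C_q=C_q(E_q)$. The dagger denotes the Moore–Penrose pseudoinverse. Conditional Schur Gram operators: for $S\subset\mathcal Q$ put $Z_S=T(V_0+\sum_{q\in S}\mathcal C_q)$, with $Y$-orthogonal projection $P_{Z_S}$. For $A\subset\mathcal Q$ disjoint from $S$ let $E_A=\bigoplus_{q\in A}E_q$ (Hilbert direct sum), $C_A(e_q)_{q\in A}=\sum_{q\in A}C_qe_q$, $Q_{A\mid S}=(I-P_{Z_S})(T\circ C_A)$ and $D_{A\mid S}=Q_{A\mid S}^*Q_{A\mid S}$; write $q$ for $A=\{q\}$. ''After quotienting exact redundancy'' means that $D_{A\mid S}$ is considered on $E_A/\ker Q_{A\mid S}$ (identified with $(\ker Q_{A\mid S})^\perp$). The spectral hypotheses are: $D_{A\mid S}\succeq A_{2k}I$ on this quotient for all disjoint $A,S\subset\mathcal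 Q$ with $|A\cup S|\le2k$, and $D_{q\mid S}\preceq B_1I$ for every single block $q\notin S$ and every conditioning set $S$ that arises. Perturbation-safe ranking estimate, applied at step $m$ to a block $q\notin S_m$: let $r_m=g-Tu_m$, with $u_m$ a minimizer of $\|g-Tv\|_Y$ over $V_0+\sum_{p\in S_m}\mathcal C_p$, and put $D=D_{q\mid S_m}$ and $b=Q_{q\mid S_m}^*r_m$, so that $G_m(q)=\langle b,D^\dagger b\rangle$. Let $\widetilde D,\widetilde b$ be the computed versions of $D,b$, and let $\widetilde G_m(q)=\langle\widetilde b,\widetilde D^\dagger\widetilde b\rangle$ be the computed marginal gain. The hypotheses are that $D\succeq A_CI$ on the quotient for some $A_C>0$, and $$\|\widetilde D-D\|\le\varepsilon_D<A_C,\qquad\|\widetilde b-b\|\le\varepsilon_b ,$$ where $A_C,\varepsilon_D,\varepsilon_b$ may depend on $m$ and $q$. The estimate then gives $|G_m(q)-\widetilde G_m(q)|\le\Xi_m(q)$ with $$\Xi_m(q)=\frac{2\|\widetilde b\|\varepsilon_b+\varepsilon_b^2}{A_C}+\frac{\|\widetilde b\|^2\varepsilon_D}{A_C(A_C-\varepsilon_D)} .$$ *)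

(* Defs.v *)
From HB Require Import structures.
From mathcomp Require Import all_boot all_order all_algebra.
From mathcomp Require Import complex.
From mathcomp Require Import all_classical all_reals all_analysis.

Set Implicit Arguments.
Unset Strict Implicit.
Unset Printing Implicit Defensive.

Import Order.TTheory GRing.Theory Num.Theory.
Import numFieldNormedType.Exports.

Local Open Scope classical_set_scope.
Local Open Scope ring_scope.

(* The scalar field is R (cplx = false) or R[i] (cplx = true); forms are linear
   in their first argument and conjugate-linear in the second. *)
Definition scalarK (R : realType) (cplx : bool) : numFieldType :=
  if cplx then (R[i] : numFieldType) else (R : numFieldType).

Definition conjK (R : realType) (cplx : bool) :
    scalarK R cplx -> scalarK R cplx :=
  if cplx is true then @conjc R else idfun.

Definition reK (R : realType) (cplx : bool) : scalarK R cplx -> R :=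
  if cplx is true then @complex.Re R else idfun.

Notation "{ 'inner' U }" := {dot U for @conjK _ _}
  (format "{ 'inner'  U }") : type_scope.

Section DirectSum.
Variables (K : nzRingType) (I : finType) (E : I -> lmodType K).

Definition dsum := {dffun forall i, E i}.

HB.instance Definition _ := Choice.on dsum.

Implicit Types e f g : dsum.

Definition dsum0 : dsum := [ffun i => 0].
Definition dsum_opp e : dsum := [ffun i => - e i].
Definition dsum_add e f : dsum := [ffun i => e i + f i].
Definition dsum_scale (a : K) e : dsum := [ffun i => a *: e i].

Fact dsum_addA : associative dsum_add.
Proof. by move=> e f g; apply/ffunP => i; rewrite !ffunE addrA. Qed.
Fact dsum_addC : commutative dsum_add.
Proof. by move=> e f; apply/ffunP => i; rewrite !ffunE addrC. Qed.
Fact dsum_add0 : left_id dsum0 dsum_add.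
Proof. by move=> e; apply/ffunP => i; rewrite !ffunE add0r. Qed.
Fact dsum_addN : left_inverse dsum0 dsum_opp dsum_add.
Proof. by move=> e; apply/ffunP => i; rewrite !ffunE addNr. Qed.

HB.instance Definition _ :=
  GRing.isZmodule.Build dsum dsum_addA dsum_addC dsum_add0 dsum_addN.

Fact dsum_scaleA a b e : dsum_scale a (dsum_scale b e) = dsum_scale (a * b) e.
Proof. by apply/ffunP => i; rewrite !ffunE scalerA. Qed.
Fact dsum_scale1 : left_id 1 dsum_scale.
Proof. by move=> e; apply/ffunP => i; rewrite !ffunE scale1r. Qed.
Fact dsum_scaleDr : right_distributive dsum_scale +%R.
Proof. by move=> a e f; apply/ffunP => i; rewrite !ffunE scalerDr. Qed.
Fact dsum_scaleDl e : {morph dsum_scale^~ e : a b / a + b}.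
Proof. by move=> a b; apply/ffunP => i; rewrite !ffunE scalerDl. Qed.

HB.instance Definition _ := GRing.Zmodule_isLmodule.Build K dsum
  dsum_scaleA dsum_scale1 dsum_scaleDr dsum_scaleDl.

Definition dsum_inner (ip : forall i, E i -> E i -> K) e f : K :=
  \sum_i ip i (e i) (f i).

End DirectSum.

Section HilbertOperators.
Variables (R : realType) (cplx : bool).
Local Notation K := (scalarK R cplx).

Definition hnorm (F : lmodType K) (ip : F -> F -> K) (x : F) : R :=
  Num.sqrt (reK (ip x x)).

Definition finite_dim_subspace (X : lmodType K) (V : set X) :=
  exists n (v : 'I_n -> X),
    V = [set x | exists a : 'I_n -> K, x = \sum_i a i *: v i].

Section Operators.
Variables (F Y : lmodType K) (ipF : F -> F -> K) (ipY : Y -> Y -> K).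

(* In the definitions by [xget] below the described object is unique, and it
   exists because F and the subspace Z are finite-dimensional where they are
   used. *)
Definition orth_proj (Z : set Y) (y : Y) : Y :=
  xget 0 [set z | Z z /\ forall w, Z w -> ipY (y - z) w = 0].

Definition adjoint (Q : F -> Y) (y : Y) : F :=
  xget 0 [set e | forall f, ipY (Q f) y = ipF f e].

Definition self_adjoint (D : F -> F) :=
  forall e f, ipF (D e) f = ipF e (D f).

Definition penrose (D P : F -> F) :=
  [/\ D \o P \o D = D, P \o D \o P = P,
      self_adjoint (D \o P) & self_adjoint (P \o D)].

Definition pseudoinverse (D : F -> F) : F -> F := xget (fun=> 0) (penrose D).

Definition opnorm (L : F -> F) : R :=
  sup [set hnorm ipF (L e) | e in [set e | hnorm ipF e <= 1]].

(* (ker Q)^perp, the concrete model of the quotient F / ker Q. *)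
Definition coker (Q : F -> Y) : set F :=
  [set e | forall f, Q f = 0 -> ipF e f = 0].

Definition quotient_ge (Q : F -> Y) (D : F -> F) (a : R) :=
  forall e, coker Q e -> a * reK (ipF e e) <= reK (ipF (D e) e).

Definition operator_le (D : F -> F) (a : R) :=
  forall e, reK (ipF (D e) e) <= a * reK (ipF e e).

(* Hypotheses of the ranking estimate for D = Q^* Q, b = Q^* r and their
   computed versions Dt, bt.  As D is considered on F / ker Q, so are the
   computed versions: Dt vanishes on ker Q and has range in (ker Q)^perp, and
   bt lies in (ker Q)^perp.  (If Dt or bt had a component in ker Q, the
   pseudoinverse of Dt could be arbitrarily large and the estimate fail.) *)
Definition ranking_hypotheses (Q : F -> Y) (D : F -> F) (b : F)
    (Dt : F -> F) (bt : F) (AC epsD epsb : R) :=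
  [/\ 0 < AC /\ quotient_ge Q D AC,
      [/\ forall e, Q e = 0 -> Dt e = 0, forall e, coker Q (Dt e) &
          coker Q bt],
      opnorm (Dt \- D) <= epsD,
      epsD < AC &
      hnorm ipF (bt - b) <= epsb].

Definition dagger_gain (D : F -> F) (b : F) : R :=
  reK (ipF b (pseudoinverse D b)).

Definition margin (bt : F) (AC epsD epsb : R) : R :=
  (2 * hnorm ipF bt * epsb + epsb ^+ 2) / AC
  + hnorm ipF bt ^+ 2 * epsD / (AC * (AC - epsD)).

End Operators.

Section Blocks.
Variables (Q : finType) (X Y : lmodType K) (E : Q -> lmodType K).
Variables (ipY : Y -> Y -> K) (ipE : forall p, E p -> E p -> K).
Variables (T : X -> Y) (g : Y) (V0 : set X) (C : forall p, E p -> X).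
Implicit Types A S : {set Q}.

Definition minimizer (V : set X) (u : X) :=
  V u /\ forall v, V v -> hnorm ipY (g - T u) <= hnorm ipY (g - T v).

Definition trial S : set X :=
  [set x | exists2 v, V0 v &
     exists e : forall p, E p, x = v + \sum_(p in S) C (e p)].

(* The infimum is attained, the trial spaces being finite-dimensional. *)
Definition min_residual S : R :=
  inf [set hnorm ipY (g - T v) ^+ 2 | v in trial S].

Definition residual_drop (u0 : X) S : R :=
  hnorm ipY (g - T u0) ^+ 2 - min_residual S.

(* (I - P_{Z_S}) (T \o L), with Z_S = T (trial S) *)
Definition schur (F : lmodType K) (L : F -> X) S (e : F) : Y :=
  T (L e) - orth_proj ipY (T @` trial S) (T (L e)).

Definition schur_gram (F : lmodType K) (ipF : F -> F -> K) (L : F -> X) S :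
    F -> F :=
  adjoint ipF ipY (schur L S) \o schur L S.

Definition joint_space A : lmodType K :=
  dsum (fun p : {p | p \in A} => E (val p)).

Definition joint_inner A : joint_space A -> joint_space A -> K :=
  dsum_inner (fun p : {p | p \in A} => @ipE (val p)).

Definition joint_block A (e : joint_space A) : X :=
  \sum_(p : {p | p \in A}) C (e p).

End Blocks.
End HilbertOperators.

(* Main.v *)
Require Import Defs.
From mathcomp Require Import all_boot all_order all_algebra.
From mathcomp Require Import complex ring lra.
From mathcomp Require Import all_classical all_reals all_analysis.

(** The theorem is the analysis of a greedy algorithm for a weakly submodular
    function, with inexact comparisons.

    Each [min_residual S] is the squared norm of [r = g - P g], with [P] the
    orthogonal projection onto [Z_S = T (trial S)]. Adding blocks with joint
    synthesis map [L] adds to [Z_S] the range of the Schur operator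
    [Q = (I - P) T L], which is orthogonal to [Z_S]. The residual therefore
    drops by [|Q x|^2], where [x] solves the normal equations [Q^* Q x = Q^* r]
    in the orthogonal complement of [ker Q] ([residual_gram]). On that
    complement the pseudoinverse of a Gram operator is a true inverse
    ([pseudoinverse_coker]), so the drop is the dagger gain ([gain_dagger]).
    The same inversion lemma covers the computed Gram operators, which stay
    coercive under the assumed perturbation although they need not be
    self-adjoint; comparing the two solutions gives [ranking_estimate].

    The combinatorial core is [joint_gain_le]: the joint gain of a set of
    blocks is at most [B1 / A2k] times the sum of the single gains. The lower
    bound controls the coefficient vector that realizes the joint gain, and
    its components are used as trial directions for the single blocks, whose
    quadratic cost the upper bound controls. With [S] the current selection
    and [A] the rest of the comparator [O], each single gain is at most the
    realized gain plus [delta m], because the computed gains of the chosen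
    block and of its competitor each err by at most the margin. Hence
    [gamma (F O - F S) <= k (gain + delta m)], so the defect contracts by
    [rho] at every step ([greedy_recursion]), and [rho ^+ k <= exp (- gamma)].

    The real and the complex case are treated together through the real form
    [rdot], the real part of the inner product. *)

Set Implicit Arguments.
Unset Strict Implicit.
Unset Printing Implicit Defensive.

Import Order.TTheory GRing.Theory Num.Theory.
Import numFieldNormedType.Exports.

Local Open Scope classical_set_scope.
Local Open Scope ring_scope.

(** * The real part of a scalar *)

Section Scalars.
Variables (R : realType) (cplx : bool).
Local Notation K := (scalarK R cplx).

(** The embedding of the reals, so that real scalars can act on a K-space. *)
Definition ofR : R -> K :=
  if cplx as c return (R -> scalarK R c) then @real_complex R else idfun.

Implicit Types (a b : K) (t : R).

Lemma reKD a b : reK (a + b) = reK a + reK b.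
Proof. by case: cplx a b => // -[a1 a2] [b1 b2]. Qed.

Lemma reK0 : reK (0 : K) = 0.
Proof. by case: cplx. Qed.

Lemma reKN a : reK (- a) = - reK a.
Proof. by case: cplx a => // -[a1 a2]. Qed.

Lemma reK_conj a : reK (conjK a) = reK a.
Proof. by case: cplx a => // -[a1 a2]. Qed.

Lemma reK_ofRM t a : reK (ofR t * a) = t * reK a.
Proof. by rewrite /ofR; case: cplx a => // -[a1 a2] /=; rewrite mul0r subr0. Qed.

Lemma conjKD a b : conjK (a + b) = conjK a + conjK b.
Proof.
by case: cplx a b => // -[a1 a2] [b1 b2] /=; congr (_ +i* _)%C; rewrite opprD.
Qed.

Lemma conjKM a b : conjK (a * b) = conjK a * conjK b.
Proof.
case: cplx a b => // -[a1 a2] [b1 b2] /=; congr (_ +i* _)%C.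
  by rewrite mulrNN.
by rewrite mulrN mulNr opprD.
Qed.

Lemma conjKK : involutive (@conjK R cplx).
Proof. by case: cplx => // -[a1 a2] /=; rewrite opprK. Qed.

Lemma conjK0 : conjK (0 : K) = 0.
Proof. by case: cplx => //=; congr (_ +i* _)%C; rewrite oppr0. Qed.

Lemma reKM_conj_ge0 a : 0 <= reK (a * conjK a).
Proof.
case: cplx a => [[a1 a2]|a] /=; last by rewrite -expr2 sqr_ge0.
by rewrite mulrN opprK addr_ge0 // -expr2 sqr_ge0.
Qed.

(** A norm square is fixed by conjugation; this is the form in which
    [reK] becomes multiplicative. *)
Lemma reKM_conj a b : conjK b = b ->
  reK (a * conjK a * b) = reK (a * conjK a) * reK b.
Proof.
case: cplx a b => [[a1 a2] [b1 b2] /= [hb]|a b] //=.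
have -> : b2 = 0 by lra.
by ring.
Qed.

Lemma reK_gt0 a : 0 < a -> 0 < reK a.
Proof. by case: cplx a => [[a1 a2]|a] //=; rewrite ltcE /= => /andP[]. Qed.

End Scalars.

(** * Finite-dimensional subspaces *)

Section Linear.
Variables (K : nzRingType) (F Y : lmodType K) (L : F -> Y).
Hypothesis linL : linear L.

Lemma lin0 : L 0 = 0.
Proof. by have := linL (-1) 0 0; rewrite scaler0 addr0 scaleN1r addNr. Qed.
Lemma linD x y : L (x + y) = L x + L y.
Proof. by have := linL 1 x y; rewrite !scale1r. Qed.
Lemma linZ a x : L (a *: x) = a *: L x.
Proof. by have := linL a x 0; rewrite !addr0 lin0 addr0. Qed.
Lemma linB x y : L (x - y) = L x - L y.
Proof. by rewrite -!scaleN1r linD linZ. Qed.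
Lemma lin_sum I (r : seq I) (P : pred I) (f : I -> F) :
  L (\sum_(i <- r | P i) f i) = \sum_(i <- r | P i) L (f i).
Proof. exact: (big_morph L linD lin0). Qed.
End Linear.

Section Subspaces.
Variables (K : fieldType) (F : lmodType K).
Implicit Types (Z : set F) (s : seq F).

Definition linsubspace Z :=
  Z 0 /\ forall (a : K) x y, Z x -> Z y -> Z (a *: x + y).

(** A span by recursion on its generators, which is what inductions on
    dimension consume. *)
Fixpoint lspan s : set F :=
  if s is v :: s' then [set x | exists a, lspan s' (x - a *: v)] else [set 0].

Definition finitely_spanned Z := exists s, Z `<=` lspan s.

(** Asking only for inclusion in a finite span makes subspaces of a
    finite-dimensional space, such as kernels, finite-dimensional for free. *)
Definition findim_subspace Z := linsubspace Z /\ finitely_spanned Z.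

Lemma linsubspaceD Z x y : linsubspace Z -> Z x -> Z y -> Z (x + y).
Proof. by case=> _ h hx hy; rewrite -[x]scale1r; apply: h. Qed.
Lemma linsubspaceZ Z a x : linsubspace Z -> Z x -> Z (a *: x).
Proof. by case=> h0 h hx; rewrite -[_ *: _]addr0; apply: h. Qed.
Lemma linsubspaceB Z x y : linsubspace Z -> Z x -> Z y -> Z (x - y).
Proof.
by move=> h hx hy; rewrite -scaleN1r; apply: linsubspaceD => //; exact: linsubspaceZ.
Qed.
Lemma linsubspace_sum Z I (r : seq I) (P : pred I) (f : I -> F) : linsubspace Z ->
  (forall i, P i -> Z (f i)) -> Z (\sum_(i <- r | P i) f i).
Proof.
by move=> h hf; elim/big_ind: _ => //; [case: h|move=> *; exact: linsubspaceD].
Qed.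

Lemma linsubspace_lspan s : linsubspace (lspan s).
Proof.
elim: s => [|v s [h0 h]]; split => //=.
- by move=> a x y -> ->; rewrite scaler0 addr0.
- by exists 0; rewrite scale0r subr0.
- move=> a x y [b hb] [c hc]; exists (a * b + c).
  suff -> : a *: x + y - (a * b + c) *: v = a *: (x - b *: v) + (y - c *: v).
    exact: h.
  by rewrite scalerBr scalerDl scalerA addrACA opprD.
Qed.

Lemma lspan_cat s t x y : lspan s x -> lspan t y -> lspan (s ++ t) (x + y).
Proof.
elim: s x => [|v s ih] x /=; first by move=> ->; rewrite add0r.
by move=> [a ha] hy; exists a; rewrite addrAC; apply: ih.
Qed.

(** Induction on dimension. If [Z] is contained in the span of [v :: s], then
    either [Z] already lies in the span of [s], or some [w] in [Z] has a
    nonzero coefficient on [v], and subtracting multiples of [w] brings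
    every vector of [Z] into the span of [s]. *)
Lemma findim_subspace_ind (P : set F -> Prop) :
  P [set 0] ->
  (forall Z w, findim_subspace Z -> P Z ->
     P [set x | exists a : K, exists2 z, Z z & x = a *: w + z]) ->
  forall Z, findim_subspace Z -> P Z.
Proof.
move=> P0 Pw Z [hZ [s]]; elim: s => [|v s ih] in Z hZ *.
  move=> h; suff -> : Z = [set 0] by [].
  by apply/seteqP; split => // x ->; case: hZ.
move=> hs; pose Z' := Z `&` lspan s.
have sZ' : linsubspace Z'.
  split; first by split; [case: hZ|case: (linsubspace_lspan s)].
  move=> a x y [? ?] [? ?].
  by split; [case: hZ => _; apply|case: (linsubspace_lspan s) => _; apply].
have fZ' : findim_subspace Z' by split=> //; exists s => x [].
have PZ' : P Z' by apply: ih => // x [].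
have [ZZ'|] := pselect (Z `<=` Z').
  by have -> : Z = Z' by apply/seteqP; split => // x [].
move/existsNP => [w /not_implyP[Zw nw]].
have [a ha] := hs _ Zw.
have a0 : a != 0.
  by apply/eqP => a0; apply: nw; split => //; move: ha; rewrite a0 scale0r subr0.
suff -> : Z = [set x | exists a : K, exists2 z, Z' z & x = a *: w + z] by apply: Pw.
apply/seteqP; split => [x Zx|x [c [z [Zz _]] ->]]; last by case: hZ => _; apply.
have [c hc] := hs _ Zx.
exists (c / a), (x - (c / a) *: w); last by rewrite addrC subrK.
split; first by apply: linsubspaceB => //; exact: linsubspaceZ.
suff -> : x - (c / a) *: w = (x - c *: v) - (c / a) *: (w - a *: v).
  have sS := linsubspace_lspan s.
  by apply: (linsubspaceB sS) => //; exact: (linsubspaceZ _ sS).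
by rewrite scalerBr scalerA divfK // opprB addrA subrK.
Qed.

End Subspaces.

Lemma lspan_image (K : fieldType) (F Y : lmodType K) (L : F -> Y) s x :
  linear L -> lspan s x -> lspan (map L s) (L x).
Proof.
move=> linL; elim: s x => [|v s ih] x /=; first by move=> ->; exact: lin0.
by case=> a /ih; rewrite (linB linL) (linZ linL) => h; exists a.
Qed.

Lemma findim_subspace_image (K : fieldType) (F Y : lmodType K) (L : F -> Y) Z :
  linear L -> findim_subspace Z -> findim_subspace (L @` Z).
Proof.
move=> linL [[h0 hZ] [s hs]]; split; last first.
  by exists (map L s) => _ [x /hs hx <-]; exact: lspan_image.
split; first by exists 0 => //; exact: lin0.
move=> a _ _ [x hx <-] [y hy <-]; exists (a *: x + y); last exact: linL.
exact: hZ.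
Qed.

Lemma finite_dim_subspace_findim (R : realType) (cplx : bool)
  (X : lmodType (scalarK R cplx)) (V : set X) :
  finite_dim_subspace V -> findim_subspace V.
Proof.
case=> n [v ->]; split; first split.
- by exists (fun=> 0); rewrite big1 // => i _; rewrite scale0r.
- move=> a x y [b ->] [c ->]; exists (fun i => a * b i + c i).
  rewrite scaler_sumr -big_split; apply: eq_bigr => i _.
  by rewrite scalerDl scalerA.
exists (map v (enum 'I_n)) => _ [a ->].
rewrite -big_enum /=; elim: (enum _) => [|i s ih]; first by rewrite big_nil.
by rewrite big_cons /=; exists (a i); rewrite addrAC subrr add0r.
Qed.

Lemma vectType_findim (K : fieldType) (F : vectType K) : findim_subspace [set: F].
Proof.
split; first by split.
exists (vbasis {:F}) => x _; rewrite (coord_vbasis (memvf x)).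
set b := vbasis _; pose c i := coord b i x.
have -> : \sum_i coord b i x *: b`_i = \sum_i c i *: tnth b i.
  by apply: eq_bigr => i _; rewrite (tnth_nth 0).
have -> : lspan b = lspan (map (tnth b) (enum 'I_(\dim {:F}))).
  by congr lspan; rewrite map_tnth_enum.
rewrite -big_enum /=; elim: (enum _) => [|i s ih]; first by rewrite big_nil.
by rewrite big_cons /=; exists (c i); rewrite addrAC subrr add0r.
Qed.

(** * Inner products *)

Section Inner.
Variables (R : realType) (cplx : bool).
Local Notation K := (scalarK R cplx).

(** A propositional form of the structure of inner products, which also
    covers the direct sum form. *)
Record is_inner (F : lmodType K) (ip : F -> F -> K) : Prop := IsInner {
  ip_linear : forall a x y z, ip (a *: x + y) z = a * ip x z + ip y z;
  ip_conj : forall x y, ip y x = conjK (ip x y);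
  ip_gt0 : forall x, x != 0 -> 0 < reK (ip x x) }.

Lemma inner_is_inner (F : lmodType K) (ip : {inner F}) : is_inner ip.
Proof.
split=> [a x y z|x y|x x0].
- exact: linearPl.
- have := @hermitian_subproof _ _ _ _ ip y x.
  by rewrite expr0 mul1r.
- by apply/reK_gt0; exact: neq0_dnorm_gt0.
Qed.

Section Geometry.
Variables (F : lmodType K) (ip : F -> F -> K).
Hypothesis iF : is_inner ip.
Implicit Types (x y z : F) (a : K) (t : R).

(** All estimates are made for the real form: it is symmetric and bilinear
    over the reals, and gives the same norm. *)
Definition rdot x y : R := reK (ip x y).

Lemma ip0l z : ip 0 z = 0.
Proof.
have := ip_linear iF (-1) 0 0 z.
by rewrite scaler0 addr0 mulN1r addNr.
Qed.
Lemma ipDl x y z : ip (x + y) z = ip x z + ip y z.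
Proof. by have := ip_linear iF 1 x y z; rewrite scale1r mul1r. Qed.
Lemma ipZl a x z : ip (a *: x) z = a * ip x z.
Proof. by have := ip_linear iF a x 0 z; rewrite addr0 ip0l addr0. Qed.
Lemma ipNl x z : ip (- x) z = - ip x z.
Proof. by rewrite -scaleN1r ipZl mulN1r. Qed.
Lemma ipBl x y z : ip (x - y) z = ip x z - ip y z.
Proof. by rewrite ipDl ipNl. Qed.
Lemma ipDr x y z : ip z (x + y) = ip z x + ip z y.
Proof. by rewrite !(ip_conj iF _ z) ipDl conjKD. Qed.
Lemma ipZr a x z : ip z (a *: x) = conjK a * ip z x.
Proof. by rewrite !(ip_conj iF _ z) ipZl conjKM. Qed.
Lemma ip0r z : ip z 0 = 0.
Proof. by rewrite (ip_conj iF) ip0l conjK0. Qed.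
Lemma ipNr x z : ip z (- x) = - ip z x.
Proof. by apply/eqP; rewrite -addr_eq0 -ipDr addNr ip0r. Qed.
Lemma ipBr x y z : ip z (x - y) = ip z x - ip z y.
Proof. by rewrite ipDr ipNr. Qed.
Lemma ip_eq0C x y : ip x y = 0 -> ip y x = 0.
Proof. by move=> h; rewrite (ip_conj iF) h conjK0. Qed.

Lemma rdotC x y : rdot x y = rdot y x.
Proof. by rewrite /rdot (ip_conj iF) reK_conj. Qed.
Lemma rdotDl x y z : rdot (x + y) z = rdot x z + rdot y z.
Proof. by rewrite /rdot ipDl reKD. Qed.
Lemma rdotDr x y z : rdot z (x + y) = rdot z x + rdot z y.
Proof. by rewrite /rdot ipDr reKD. Qed.
Lemma rdotNl x z : rdot (- x) z = - rdot x z.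
Proof. by rewrite /rdot ipNl reKN. Qed.
Lemma rdotNr x z : rdot z (- x) = - rdot z x.
Proof. by rewrite /rdot ipNr reKN. Qed.
Lemma rdotBl x y z : rdot (x - y) z = rdot x z - rdot y z.
Proof. by rewrite rdotDl rdotNl. Qed.
Lemma rdotBr x y z : rdot z (x - y) = rdot z x - rdot z y.
Proof. by rewrite rdotDr rdotNr. Qed.
Lemma rdotZl t x z : rdot (ofR cplx t *: x) z = t * rdot x z.
Proof. by rewrite /rdot ipZl reK_ofRM. Qed.
Lemma rdotZr t x z : rdot z (ofR cplx t *: x) = t * rdot z x.
Proof. by rewrite rdotC rdotZl rdotC. Qed.
Lemma rdot0l z : rdot 0 z = 0.
Proof. by rewrite /rdot ip0l reK0. Qed.

Lemma rdot_ge0 x : 0 <= rdot x x.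
Proof.
by have [->|/(ip_gt0 iF)/ltW//] := eqVneq x 0; rewrite rdot0l.
Qed.
Lemma rdot_eq0 x : rdot x x = 0 -> x = 0.
Proof.
by move=> h; apply/eqP; apply: contraT => /(ip_gt0 iF); rewrite [reK _]h ltxx.
Qed.
Lemma ip_neq0 x : x != 0 -> ip x x != 0.
Proof. by move/(ip_gt0 iF) => h; apply: contraTneq h => ->; rewrite reK0 ltxx. Qed.
Lemma hnorm_ge0 x : 0 <= hnorm ip x. Proof. exact: sqrtr_ge0. Qed.
Lemma hnorm_sqr x : hnorm ip x ^+ 2 = rdot x x.
Proof. by rewrite sqr_sqrtr //; exact: rdot_ge0. Qed.
Lemma hnorm0 : hnorm ip 0 = 0.
Proof. by rewrite /hnorm ip0l reK0 sqrtr0. Qed.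
Lemma hnorm_eq0 x : hnorm ip x = 0 -> x = 0.
Proof. by move=> h; apply: rdot_eq0; rewrite -hnorm_sqr h expr0n. Qed.
Lemma hnorm_le x t : 0 <= t -> rdot x x <= t ^+ 2 -> hnorm ip x <= t.
Proof. by move=> t0; rewrite -hnorm_sqr ler_pXn2r // ?nnegrE // hnorm_ge0. Qed.
Lemma hnorm_opp x : hnorm ip (- x) = hnorm ip x.
Proof. by rewrite /hnorm ipNl ipNr opprK. Qed.

(** Positivity of the squared norm of [|y|^2 x - [x,y] y], which is [|y|^2]
    times [|x|^2 |y|^2 - [x,y]^2]. *)
Lemma cauchy_schwarz x y : `|rdot x y| <= hnorm ip x * hnorm ip y.
Proof.
rewrite -(@ler_pXn2r _ 2) ?nnegrE ?mulr_ge0 ?hnorm_ge0 //.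
rewrite real_normK ?num_real // exprMn !hnorm_sqr.
have [->|y0] := eqVneq y 0; first by rewrite (rdotC x) !rdot0l expr0n /= mulr0.
have ygt0 : 0 < rdot y y := ip_gt0 iF y0.
have := rdot_ge0 (ofR cplx (rdot y y) *: x - ofR cplx (rdot x y) *: y).
rewrite rdotBl !rdotBr !rdotZl !rdotZr (rdotC y x).
rewrite [X in 0 <= X](_ : _ = rdot y y * (rdot x x * rdot y y - rdot x y ^+ 2)); last by ring.
by rewrite pmulr_rge0 // subr_ge0.
Qed.

Lemma hnorm_triangle x y : hnorm ip (x + y) <= hnorm ip x + hnorm ip y.
Proof.
apply: hnorm_le; first by rewrite addr_ge0 // hnorm_ge0.
rewrite rdotDl !rdotDr (rdotC y x) sqrrD !hnorm_sqr.
have := cauchy_schwarz x y; have := ler_norm (rdot x y); lra.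
Qed.

Lemma hnormZ_ofR t x : 0 <= t -> hnorm ip (ofR cplx t *: x) = t * hnorm ip x.
Proof.
move=> t0; rewrite /hnorm -!/(rdot _ _) rdotZl rdotZr mulrA sqrtrM ?mulr_ge0 //.
by rewrite -expr2 sqrtr_sqr ger0_norm.
Qed.

Lemma hnormZ a x : hnorm ip (a *: x) = Num.sqrt (reK (a * conjK a)) * hnorm ip x.
Proof.
rewrite /hnorm ipZl ipZr mulrA reKM_conj ?sqrtrM ?reKM_conj_ge0 //.
by rewrite -(ip_conj iF).
Qed.

Lemma pythagoras x y : ip x y = 0 ->
  rdot (x + y) (x + y) = rdot x x + rdot y y.
Proof.
move=> h; rewrite rdotDl !rdotDr (rdotC y x) {2 3}/rdot h reK0; ring.
Qed.

(** By induction on dimension: passing from [Z] to [Z + K w], replace [w] by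
    its component [w - p] orthogonal to [Z] and add the usual Gram-Schmidt
    term. *)
Lemma projection_exists Z : findim_subspace Z -> forall y, exists2 z, Z z &
  forall w, Z w -> ip (y - z) w = 0.
Proof.
move=> hZ; elim/findim_subspace_ind: Z / hZ => [y|Z w [hZ _] ih y].
  by exists 0 => // _ ->; rewrite ip0r.
have [p Zp hp] := ih w; have [z Zz hz] := ih y.
have [w0|w0] := eqVneq (w - p) 0.
  exists z; first by exists 0, z => //; rewrite scale0r add0r.
  move=> _ [a [z' Zz' ->]]; apply: hz; apply: linsubspaceD => //.
  by apply: linsubspaceZ => //; rewrite (subr0_eq w0).
pose c := ip y (w - p) / ip (w - p) (w - p).
exists (z + c *: (w - p)).
  exists c, (z - c *: p); last by rewrite scalerBr addrCA.
  by apply: linsubspaceB => //; exact: linsubspaceZ.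
have hzw : ip z (w - p) = 0 by apply/ip_eq0C/hp.
have e1 : ip (y - (z + c *: (w - p))) (w - p) = 0.
  by rewrite ipBl ipDl ipZl hzw add0r divfK ?ip_neq0 ?subrr.
have e2 z' : Z z' -> ip (y - (z + c *: (w - p))) z' = 0.
  by move=> h; rewrite opprD addrA ipBl ipZl hz // hp // mulr0 subr0.
move=> _ [a [z' Zz' ->]].
have -> : a *: w + z' = a *: (w - p) + (a *: p + z').
  by rewrite scalerBr addrA subrK.
by rewrite ipDr ipZr e1 mulr0 add0r e2 //; case: hZ => _; apply.
Qed.

Lemma orth_projP Z y : findim_subspace Z ->
  Z (orth_proj ip Z y) /\ forall w, Z w -> ip (y - orth_proj ip Z y) w = 0.
Proof.
move=> /projection_exists /(_ y) [z Zz hz].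
by rewrite /orth_proj; apply: (@xgetPex _ 0 [set z | Z z /\ _]); exists z.
Qed.

Lemma orth_proj_uniq Z y z : findim_subspace Z ->
  Z z -> (forall w, Z w -> ip (y - z) w = 0) -> orth_proj ip Z y = z.
Proof.
move=> hZ Zz hz; have [Zp hp] := orth_projP y hZ.
apply/eqP; rewrite -subr_eq0; apply/eqP/rdot_eq0.
have ZZ : Z (orth_proj ip Z y - z) by apply: linsubspaceB => //; case: hZ.
rewrite /rdot {1}(_ : _ - z = (y - z) - (y - orth_proj ip Z y)).
  by rewrite ipBl hz // hp // subr0 reK0.
by rewrite opprB [RHS]addrC addrA subrK.
Qed.

Lemma orth_proj_linear Z : findim_subspace Z -> linear (orth_proj ip Z).
Proof.
move=> hZ a x y; have [Zx hx] := orth_projP x hZ.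
have [Zy hy] := orth_projP y hZ.
apply: orth_proj_uniq => //; first by case: hZ => -[_ h] _; apply: h.
move=> w Zw; rewrite opprD addrACA -scalerBr (ip_linear iF) hx // hy //.
by rewrite mulr0 addr0.
Qed.

End Geometry.

Section Adjoint.
Variables (F Y : lmodType K) (ipF : F -> F -> K) (ipY : Y -> Y -> K).
Hypotheses (iF : is_inner ipF) (iY : is_inner ipY) (fF : findim_subspace [set: F]).
Implicit Types (e f : F) (L : F -> Y).

Lemma findim_subspace_sub (Z : set F) : linsubspace Z -> findim_subspace Z.
Proof. by move=> hZ; split => //; case: fF => _ [s hs]; exists s => x _; apply: hs. Qed.

(** The representing vector is a multiple of the component, orthogonal to
    the kernel, of any vector outside it. *)
Lemma riesz (phi : F -> K) :
  (forall a x y, phi (a *: x + y) = a * phi x + phi y) ->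
  exists e, forall f, phi f = ipF f e.
Proof.
move=> linp.
have phi0 : phi 0 = 0.
  by have := linp (-1) 0 0; rewrite scaler0 addr0 mulN1r addNr.
pose N : set F := [set x | phi x = 0].
have sN : linsubspace N.
  by split => // a x y; rewrite /N /= linp => -> ->; rewrite mulr0 addr0.
have [h|/existsNP[f0 hf0]] := pselect (forall f, phi f = 0).
  by exists 0 => f; rewrite h ip0r.
have [p Np hp] := projection_exists iF (findim_subspace_sub sN) f0.
set w := f0 - p in hp.
have phiw : phi w = phi f0.
  by rewrite /w addrC -scaleN1r linp Np mulr0 add0r.
have w0 : w != 0 by apply: contra_not_neq hf0 => w0; rewrite -phiw w0.
exists (conjK (phi w / ipF w w) *: w) => f.
rewrite ipZr // conjKK.
have Nf : N (f - (phi f / phi w) *: w).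
  rewrite /N /= addrC -scaleNr linp mulNr divfK ?addNr //.
  by rewrite phiw; apply/eqP.
have /ip_eq0C := hp _ Nf; move=> /(_ iF).
rewrite ipBl // ipZl // => /subr0_eq ->.
rewrite mulrC.
have phiw0 : phi w != 0 by rewrite phiw; apply/eqP.
by rewrite mulrAC -mulrA divfK ?ip_neq0 // divfK.
Qed.

Lemma adjointP L : linear L -> forall y f, ipY (L f) y = ipF f (adjoint ipF ipY L y).
Proof.
move=> linL y; pose P := [set e | forall f, ipY (L f) y = ipF f e].
have [e he] : exists e, P e.
  by apply: riesz => a u v; rewrite linL (ip_linear iY).
by rewrite /adjoint; apply: (@xgetPex _ 0 P); exists e.
Qed.

Lemma ip_inj e f : (forall x, ipF x e = ipF x f) -> e = f.
Proof.
move=> h; apply/subr0_eq/(rdot_eq0 iF).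
by rewrite /rdot ipBr // h subrr reK0.
Qed.

Lemma adjoint_linear L : linear L -> linear (adjoint ipF ipY L).
Proof.
move=> linL a x y; apply: ip_inj => f.
by rewrite -adjointP // !ipDr // !ipZr // !adjointP.
Qed.

(** Induction on dimension: both components of [a (w - p) + v], with [p] the
    projection of [w] and [v] in [Z], are bounded by the norm of the sum. *)
Lemma linear_bounded L : linear L ->
  exists2 M, 0 <= M & forall x, hnorm ipY (L x) <= M * hnorm ipF x.
Proof.
move=> linL; suff h Z : findim_subspace Z ->
    exists2 M, 0 <= M & forall x, Z x -> hnorm ipY (L x) <= M * hnorm ipF x.
  by have [M M0 hM] := h _ fF; exists M => // x; apply: hM.
move=> hZ; elim/findim_subspace_ind: Z / hZ => [|Z w hZ [M M0 hM]].
  by exists 0 => // x ->; rewrite (lin0 linL) hnorm0 // mul0r.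
have [p Zp hp] := projection_exists iF hZ w.
have [sZ _] := hZ.
have [w0|w0] := eqVneq (w - p) 0.
  exists M => // _ [a [z Zz ->]]; apply: hM; apply: linsubspaceD => //.
  by apply: linsubspaceZ => //; rewrite (subr0_eq w0).
have nw : 0 < hnorm ipF (w - p).
  rewrite lt_def hnorm_ge0 andbT; apply: contra_neq w0; exact: hnorm_eq0.
exists (M + hnorm ipY (L (w - p)) / hnorm ipF (w - p)).
  by rewrite addr_ge0 // divr_ge0 ?hnorm_ge0.
move=> _ [a [z Zz ->]].
have -> : a *: w + z = a *: (w - p) + (a *: p + z).
  by rewrite scalerBr addrA subrK.
set v := a *: p + z.
have Zv : Z v by case: sZ => _; apply.
have o : ipF (a *: (w - p)) v = 0 by rewrite ipZl // hp // mulr0.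
have le1 : hnorm ipF v <= hnorm ipF (a *: (w - p) + v).
  apply: hnorm_le => //; first exact: hnorm_ge0.
  by rewrite hnorm_sqr // (pythagoras iF o) lerDr rdot_ge0.
have le2 : hnorm ipF (a *: (w - p)) <= hnorm ipF (a *: (w - p) + v).
  apply: hnorm_le => //; first exact: hnorm_ge0.
  by rewrite hnorm_sqr // (pythagoras iF o) lerDl rdot_ge0.
rewrite (linD linL) (le_trans (hnorm_triangle iY _ _)) // addrC mulrDl.
apply: lerD; first by rewrite (le_trans (hM _ Zv)) // ler_wpM2l.
rewrite (linZ linL) hnormZ // mulrAC.
rewrite ler_pdivlMr // mulrAC -hnormZ //.
by rewrite mulrC ler_wpM2l // hnorm_ge0.
Qed.

End Adjoint.

(** Boundedness of [L] is what makes the supremum defining [opnorm] an upper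
    bound; the rest is rescaling to the unit ball. *)
Lemma opnorm_bound (F : lmodType K) (ipF : F -> F -> K) (L : F -> F) (c : R) :
  is_inner ipF -> findim_subspace [set: F] -> linear L -> opnorm ipF L <= c ->
  forall e, hnorm ipF (L e) <= c * hnorm ipF e.
Proof.
move=> iF fF linL hc e.
have [M M0 hM] := linear_bounded iF iF fF linL.
have [->|e0] := eqVneq e 0; first by rewrite (lin0 linL) hnorm0 // mulr0.
have ne : 0 < hnorm ipF e.
  rewrite lt_def hnorm_ge0 andbT; apply: contra_neq e0; exact: hnorm_eq0.
pose f := ofR cplx (hnorm ipF e)^-1 *: e.
have nf : hnorm ipF f = 1 by rewrite hnormZ_ofR ?invr_ge0 ?hnorm_ge0 // mulVf ?gt_eqF.
have : hnorm ipF (L f) <= c.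
  apply: le_trans hc; apply: ub_le_sup; last by exists f => //=; rewrite nf.
  exists M => _ [x /= hx <-]; rewrite (le_trans (hM _)) // ler_piMr //.
rewrite (linZ linL) hnormZ_ofR ?invr_ge0 ?hnorm_ge0 //.
by rewrite ler_pdivrMl // mulrC.
Qed.

End Inner.

(** * Pseudoinverses and the ranking estimate *)

Section Pseudoinverse.
Variables (R : realType) (cplx : bool).
Local Notation K := (scalarK R cplx).
Variables (F Y : lmodType K) (ipF : F -> F -> K) (ipY : Y -> Y -> K).
Hypotheses (iF : is_inner ipF) (iY : is_inner ipY) (fF : findim_subspace [set: F]).
Variable Q : F -> Y.
Hypothesis linQ : linear Q.
Implicit Types (e f w : F) (L : F -> F).

Local Notation W := (coker ipF Q).

Lemma ker_linsubspace : linsubspace [set e | Q e = 0].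
Proof.
split=> [|a x y /= hx hy]; first exact: lin0.
by rewrite /= linQ hx hy scaler0 addr0.
Qed.

Lemma coker_linsubspace : linsubspace W.
Proof.
split=> [|a x y hx hy] f hf; first by rewrite ip0l.
by rewrite (ip_linear iF) hx // hy // mulr0 addr0.
Qed.

(** This is the identification of [F / ker Q] with the orthogonal complement
    of the kernel: every class has a representative there. *)
Lemma coker_split e : exists2 w, W w & Q (e - w) = 0.
Proof.
have [p Np hp] := projection_exists iF (findim_subspace_sub fF ker_linsubspace) e.
by exists (e - p) => //; rewrite opprB addrC subrK.
Qed.

Lemma coker_ker0 w : W w -> Q w = 0 -> w = 0.
Proof. by move=> Ww Qw; apply: (rdot_eq0 iF); rewrite /rdot Ww // reK0. Qed.

(** Such an [A] is the orthogonal projector onto [W]. Both products of an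
    operator on [W] with its inverse on [W] are of this kind. *)
Lemma coker_projector_self_adjoint (A : F -> F) :
  (forall e, W (A e) /\ Q (e - A e) = 0) -> self_adjoint ipF A.
Proof.
move=> hA e f; have [We Qe] := hA e; have [Wf Qf] := hA f.
have h1 := We _ Qf; have h2 := Wf _ Qe.
move: h1; rewrite ipBr // => /subr0_eq ->.
by move: h2 => /(ip_eq0C iF); rewrite ipBl // => /subr0_eq ->.
Qed.

Section Invertible.
Variable L : F -> F.
Hypotheses (linL : linear L) (kerL : forall e, Q e = 0 -> L e = 0)
  (ranL : forall e, W (L e))
  (posL : forall w, W w -> w != 0 -> 0 < rdot ipF (L w) w).

Lemma coker_injective w : W w -> L w = 0 -> w = 0.
Proof.
move=> Ww Lw; apply/eqP; apply: contraT => /(posL Ww).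
by rewrite Lw rdot0l // ltxx.
Qed.

(** The Lax-Milgram argument: the range of [L] on [W] is
    finite-dimensional, hence has a projection, and the defect
    [z = b - L w] is orthogonal to [L z], so it vanishes by positivity. *)
Lemma coker_surjective b : W b -> exists2 w, W w & L w = b.
Proof.
move=> Wb; have sW := coker_linsubspace.
have hW : findim_subspace (L @` W) by apply: findim_subspace_image => //; exact: findim_subspace_sub.
have [_ [w Ww <-] hz] := projection_exists iF hW b.
exists w => //; apply/esym/subr0_eq/eqP; apply: contraT => z0.
have Wz : W (b - L w) by exact: (linsubspaceB sW).
have := posL Wz z0.
by rewrite rdotC // /rdot (hz (L (b - L w))) ?reK0 ?ltxx //; exists (b - L w).
Qed.

(** Invert [L] on [W] after projecting onto [W]. The computed Gram
    operators need not be self-adjoint, so no spectral decomposition is used. *)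
Lemma penrose_exists : exists P, penrose ipF L P.
Proof.
have /choice[P hP] : forall e, exists w, W w /\ Q (e - L w) = 0.
  move=> e; have [p Wp hp] := coker_split e; have [w Ww hw] := coker_surjective Wp.
  by exists w; rewrite hw.
have LPL e : L (P (L e)) = L e.
  have [WP QP] := hP (L e).
  by apply/esym/subr0_eq/coker_ker0 => //; exact: (linsubspaceB coker_linsubspace).
have PLw w : W w -> P (L w) = w.
  move=> Ww; have [WP _] := hP (L w).
  apply/subr0_eq/coker_injective; first exact: (linsubspaceB coker_linsubspace).
  by rewrite (linB linL) LPL subrr.
exists P; split.
- by apply/funext => e /=; exact: LPL.
- by apply/funext => e /=; apply: PLw; have [] := hP e.
- by apply: coker_projector_self_adjoint => e /=; have [_ ?] := hP e.
- apply: coker_projector_self_adjoint => e /=; split; first by have [] := hP (L e).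
  have [w Ww hw] := coker_split e.
  suff -> : P (L e) = w by [].
  have /eqP := kerL hw; rewrite (linB linL) subr_eq0 => /eqP ->; exact: PLw.
Qed.

(** On [W] the pseudoinverse is the inverse of [L]. This is read off the
    Penrose equations: [P L] is self-adjoint and kills [ker Q], so its range
    is orthogonal to [ker Q]. *)
Lemma pseudoinverse_coker b : W b ->
  W (pseudoinverse ipF L b) /\ L (pseudoinverse ipF L b) = b.
Proof.
move=> Wb; have [DPD _ _ PD] : penrose ipF L (pseudoinverse ipF L).
  by have [P hP] := penrose_exists; apply: (@xgetPex _ _ (penrose ipF L)); exists P.
set P := pseudoinverse ipF L in DPD PD *.
have [y Wy <-] := coker_surjective Wb.
split; last exact: (congr1 (fun h => h y) DPD).
have PL0 : P (L 0) = 0.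
  apply: (ip_inj iF) => x; rewrite ip0r //.
  by have := PD x 0; rewrite /= ip0r // => /esym; apply/esym.
move=> f Qf; rewrite [LHS](PD y f) /= (kerL Qf) -[X in P X](lin0 linL).
by rewrite PL0 ip0r.
Qed.

End Invertible.

Lemma coercive_hnorm_le L a w : 0 < a ->
  a * rdot ipF w w <= rdot ipF (L w) w -> hnorm ipF w <= hnorm ipF (L w) / a.
Proof.
move=> a0 h; rewrite ler_pdivlMr // mulrC.
have [w0|w0] := eqVneq w 0; first by rewrite w0 hnorm0 // mulr0 hnorm_ge0.
have nw : 0 < hnorm ipF w.
  rewrite lt_def hnorm_ge0 andbT; apply: contra_neq w0; exact: hnorm_eq0.
rewrite -(ler_pM2r nw) -mulrA -expr2 hnorm_sqr // (le_trans h) //.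
by rewrite (le_trans (ler_norm _)) // cauchy_schwarz.
Qed.

Local Notation D := (adjoint ipF ipY Q \o Q).

Lemma adjoint_coker y : W (adjoint ipF ipY Q y).
Proof.
move=> f Qf; apply: (ip_eq0C iF); rewrite -(adjointP iF iY fF linQ) Qf.
exact: ip0l.
Qed.

Lemma gram_linear : linear D.
Proof. by move=> a x y /=; rewrite linQ (adjoint_linear iF iY fF linQ). Qed.

Lemma rdot_gram e f : rdot ipF (D e) f = rdot ipY (Q e) (Q f).
Proof. by rewrite rdotC // /rdot /= -(adjointP iF iY fF linQ) -/(rdot _ _ _) rdotC. Qed.

Lemma gram_ker e : Q e = 0 -> D e = 0.
Proof.
move=> Qe /=; rewrite Qe; apply: (ip_inj iF) => x.
by rewrite -(adjointP iF iY fF linQ) !ip0r.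
Qed.

(** A vector orthogonal to [ker Q] and killed by [Q] is zero. *)
Lemma gram_pos w : W w -> w != 0 -> 0 < rdot ipF (D w) w.
Proof.
move=> Ww w0; rewrite rdot_gram lt_def rdot_ge0 // andbT.
apply: contra_neq w0 => /(rdot_eq0 iY); exact: coker_ker0.
Qed.

Lemma gram_pseudoinverse b : W b ->
  W (pseudoinverse ipF D b) /\ D (pseudoinverse ipF D b) = b.
Proof.
apply: (pseudoinverse_coker gram_linear gram_ker _ gram_pos) => e.
exact: adjoint_coker.
Qed.

(** Write [x = D^+ b], [y = D^+ bt], [z = Dt^+ bt], [d = b - bt] and
    [s = x - y], so that [D s = d]. Then
    [<b,x> - <bt,z> = 2 <bt,s> + <d,s> + <bt,y - z>], where the coercivity of
    [D] gives [|s| <= epsb / AC], and the identity [D (y - z) = (Dt - D) z]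
    together with the coercivity constant [AC - epsD] of [Dt] bounds
    [y - z]. *)
Lemma ranking_estimate b Dt bt AC epsD epsb : linear Dt -> W b ->
  ranking_hypotheses ipF Q D b Dt bt AC epsD epsb ->
  `|dagger_gain ipF D b - dagger_gain ipF Dt bt| <= margin ipF bt AC epsD epsb.
Proof.
move=> linDt Wb [[A0 hA] [kDt rDt Wbt] hD hlt hb].
have sW := coker_linsubspace.
have AD0 : 0 < AC - epsD by rewrite subr_gt0.
have linE : linear (Dt \- D).
  by move=> a x y; rewrite /= linDt [adjoint _ _ _ _]gram_linear scalerBr opprD addrACA.
have bE e := opnorm_bound iF fF linE hD e.
have coD w : W w -> AC * rdot ipF w w <= rdot ipF (D w) w by exact: hA.
(* Perturbation keeps a coercivity constant AC - epsD, so Dt is invertible on W. *)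
have coDt w : W w -> (AC - epsD) * rdot ipF w w <= rdot ipF (Dt w) w.
  move=> Ww; have := coD _ Ww; have := cauchy_schwarz iF ((Dt \- D) w) w.
  rewrite ler_norml => /andP[h _].
  have := ler_wpM2r (hnorm_ge0 ipF w) (bE w); rewrite -mulrA -expr2 hnorm_sqr //.
  move: h; rewrite [rdot _ ((_ \- _) w) w](rdotBl iF).
  lra.
have posDt w : W w -> w != 0 -> 0 < rdot ipF (Dt w) w.
  move=> Ww w0; apply: lt_le_trans (coDt _ Ww); rewrite mulr_gt0 //.
  exact: (ip_gt0 iF).
have [Wx Dx] := gram_pseudoinverse Wb.
have [Wy Dy] := gram_pseudoinverse Wbt.
have [Wz Dz] := pseudoinverse_coker linDt kDt rDt posDt Wbt.
rewrite /dagger_gain -!/(rdot ipF _ _).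
move: (pseudoinverse ipF D b) (pseudoinverse ipF D bt) (pseudoinverse ipF Dt bt)
  Wx Dx Wy Dy Wz Dz.
move=> x y z Wx Dx Wy Dy Wz Dz.
set d := b - bt; set s := x - y.
have Ws : W s by exact: (linsubspaceB sW).
have Ds : D s = d by rewrite /s (linB gram_linear) Dx Dy.
have nd : hnorm ipF d <= epsb by rewrite -(hnorm_opp iF) opprB.
have ns : hnorm ipF s <= epsb / AC.
  apply: le_trans (coercive_hnorm_le A0 (coD _ Ws)) _.
  by rewrite Ds ler_pM2r ?invr_gt0.
have nz : hnorm ipF z <= hnorm ipF bt / (AC - epsD).
  by rewrite -[in leRHS]Dz; apply: coercive_hnorm_le => //; exact: coDt.
have nyz : hnorm ipF (y - z) <= hnorm ipF bt * epsD / (AC * (AC - epsD)).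
  have Wyz : W (y - z) by exact: (linsubspaceB sW).
  apply: le_trans (coercive_hnorm_le A0 (coD _ Wyz)) _.
  rewrite [AC * _]mulrC invfM mulrA ler_pM2r ?invr_gt0 //.
  have -> : D (y - z) = (Dt \- D) z by rewrite (linB gram_linear) Dy /= Dz.
  apply: le_trans (bE z) _; rewrite mulrAC mulrC.
  have [z0|z0] := eqVneq z 0.
    by rewrite -Dz z0 (lin0 linDt) hnorm0 // !mul0r.
  rewrite ler_wpM2r //.
  have nz0 : 0 < hnorm ipF z.
    rewrite lt_def hnorm_ge0 andbT; apply: contra_neq z0; exact: hnorm_eq0.
  by rewrite -(pmulr_lge0 _ nz0) (le_trans _ (bE z)) // hnorm_ge0.
have -> : rdot ipF b x - rdot ipF bt z =
    rdot ipF bt s + rdot ipF d y + rdot ipF d s + rdot ipF bt (y - z).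
  have -> : b = bt + d by rewrite /d addrC subrK.
  have -> : x = y + s by rewrite /s addrC subrK.
  by rewrite !(rdotDl, rdotDr, rdotNr) //; ring.
have -> : rdot ipF d y = rdot ipF bt s.
  by rewrite -Ds rdot_gram -Dy rdot_gram rdotC.
have B0 := hnorm_ge0 ipF bt.
have e1 : `|rdot ipF bt s| <= hnorm ipF bt * (epsb / AC).
  by rewrite (le_trans (cauchy_schwarz iF _ _)) // ler_wpM2l.
have e2 : `|rdot ipF d s| <= epsb * (epsb / AC).
  by rewrite (le_trans (cauchy_schwarz iF _ _)) // ler_pM // hnorm_ge0.
have e3 : `|rdot ipF bt (y - z)| <= hnorm ipF bt * (hnorm ipF bt * epsD / (AC * (AC - epsD))).
  by rewrite (le_trans (cauchy_schwarz iF _ _)) // ler_wpM2l.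
have -> : margin ipF bt AC epsD epsb = hnorm ipF bt * (epsb / AC) + hnorm ipF bt * (epsb / AC)
   + epsb * (epsb / AC) + hnorm ipF bt * (hnorm ipF bt * epsD / (AC * (AC - epsD))).
  rewrite /margin; field; by rewrite !gt_eqF.
by do 3 (apply: le_trans (ler_normD _ _) _; apply: lerD => //).
Qed.

End Pseudoinverse.

(** * Finite sums of spaces *)

Lemma lspan_sum (K : fieldType) (F : lmodType K) (I : Type) (Z : I -> set F)
  (r : seq I) (P : pred I) : (forall i, finitely_spanned (Z i)) ->
  exists s, forall f : I -> F, (forall i, Z i (f i)) ->
    lspan s (\sum_(i <- r | P i) f i).
Proof.
move=> /choice[s hs]; elim: r => [|i r [t ht]].
  by exists [::] => f _; rewrite big_nil.
exists (s i ++ t) => f hf; rewrite big_cons; case: ifP => _.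
  by apply: lspan_cat; [exact/hs/hf|exact: ht].
rewrite -[X in lspan _ X]add0r; apply: lspan_cat; last exact: ht.
by case: (linsubspace_lspan (s i)).
Qed.

Lemma sum_setU_disjoint (V : nmodType) (I : finType) (A B : {set I}) (f : I -> V) :
  [disjoint A & B]%B ->
  \sum_(i in A :|: B) f i = \sum_(i in A) f i + \sum_(i in B) f i.
Proof.
move=> dAB; rewrite -bigU //=; apply: eq_bigl => i; by rewrite !inE.
Qed.

Section DirectSumTheory.
Variables (R : realType) (cplx : bool).
Local Notation K := (scalarK R cplx).
Variables (I : finType) (E : I -> lmodType K).

Definition dsum_inj i (x : E i) : dsum E :=
  [ffun j => @dfwith I E (fun=> 0) i x j].

Lemma dsum_inj_linear i : linear (@dsum_inj i).
Proof.
move=> a x y; apply/ffunP => j; rewrite !ffunE.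
case: (eqVneq i j) => [ij|ij]; last by rewrite !dfwithout // scaler0 addr0.
by case: _ / ij; rewrite !dfwithin.
Qed.

Lemma dsum_sumE (r : seq I) (P : pred I) (f : I -> dsum E) j :
  (\sum_(i <- r | P i) f i) j = \sum_(i <- r | P i) f i j.
Proof. by elim/big_rec2: _ => [|i _ y _ <-]; rewrite ffunE. Qed.

Lemma dsum_findim : (forall i, findim_subspace [set: E i]) -> findim_subspace [set: dsum E].
Proof.
move=> fE; split; first by split.
have [|s hs] := @lspan_sum K (dsum E) I (fun i => @dsum_inj i @` [set: E i])
  (index_enum I) predT.
  by move=> i; case: (findim_subspace_image (@dsum_inj_linear i) (fE i)).
exists s => e _; suff -> : e = \sum_i dsum_inj (e i).
  by apply: hs => i; exists (e i).
apply/ffunP => j; rewrite dsum_sumE (bigD1 j) //= ffunE dfwithin big1 ?addr0 // => i ij.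
by rewrite ffunE dfwithout.
Qed.

Lemma dsum_is_inner (ip : forall i, E i -> E i -> K) :
  (forall i, is_inner (@ip i)) -> is_inner (dsum_inner ip).
Proof.
move=> hip; split=> [a x y z|x y|x x0]; rewrite /dsum_inner.
- rewrite mulr_sumr -big_split; apply: eq_bigr => i _.
  by rewrite !ffunE (ip_linear (hip i)).
- rewrite (big_morph _ (@conjKD R cplx) (conjK0 R cplx)).
  by apply: eq_bigr => i _; rewrite -(ip_conj (hip i)).
- rewrite (big_morph _ (@reKD R cplx) (reK0 R cplx)).
  have [i xi] : exists i, x i != 0.
    apply/existsP; apply: contraNT x0; rewrite negb_exists => /forallP h.
    by apply/eqP/ffunP => i; rewrite ffunE; apply/eqP/negbNE/h.
  rewrite (bigD1 i) //= ltr_pwDl ?(ip_gt0 (hip i)) //.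
  by apply: sumr_ge0 => j _; exact: (rdot_ge0 (hip j)).
Qed.

End DirectSumTheory.

(** * Residuals and conditional Schur operators *)

Section Blocks.
Variables (R : realType) (cplx : bool).
Local Notation K := (scalarK R cplx).
Variables (X Y : lmodType K) (ipY : Y -> Y -> K) (iY : is_inner ipY).
Variables (T : X -> Y) (linT : linear T) (g : Y) (V0 : set X) (fV0 : findim_subspace V0).
Variables (Q : finType) (E : Q -> lmodType K).
Variables (ipE : forall p, E p -> E p -> K) (iE : forall p, is_inner (@ipE p)).
Hypothesis fE : forall p, findim_subspace [set: E p].
Variables (C : forall p, E p -> X) (linC : forall p, linear (@C p)).
Implicit Types (A S : {set Q}).
Arguments C : clear implicits.
Arguments ipE : clear implicits.
Arguments linC : clear implicits.
Arguments iE : clear implicits.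
Arguments fE : clear implicits.

Local Notation trialS S := (trial V0 C S).
Local Notation Zs S := (T @` trialS S).
Local Notation proj S := (orth_proj ipY (Zs S)).
Local Notation rsd S := (g - proj S g).
Local Notation rn S := (rdot ipY (rsd S) (rsd S)).

Lemma trial_linsubspace S : linsubspace (trialS S).
Proof.
have [[h0 hV] _] := fV0; split.
  exists 0 => //; exists (fun=> 0); rewrite add0r big1 // => p _.
  exact: (lin0 (linC p)).
move=> a _ _ [v hv [e ->]] [w hw [f ->]].
exists (a *: v + w); first exact: hV.
exists (fun p => a *: e p + f p).
rewrite scalerDr addrACA; congr (_ + _).
rewrite scaler_sumr -big_split; apply: eq_bigr => p _.
by rewrite linC.
Qed.

Lemma trial_findim S : findim_subspace (trialS S).
Proof.
split; first exact: trial_linsubspace.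
have [_ [s0 hs0]] := fV0.
have [|s hs] := @lspan_sum K X Q (fun p => C p @` [set: E p]) (index_enum Q) (mem S).
  by move=> p; case: (findim_subspace_image (linC p) (fE p)).
exists (s0 ++ s) => _ [v hv [e ->]]; apply: lspan_cat; first exact: hs0.
by apply: (hs (fun p => C p (e p))) => p; exists (e p).
Qed.

Lemma image_trial_findim S : findim_subspace (Zs S).
Proof. by apply: findim_subspace_image => //; exact: trial_findim. Qed.

Lemma trial_set0 : trialS finset.set0 = V0.
Proof.
apply/seteqP; split=> [_ [v hv [e ->]]|v hv]; first by rewrite big_set0 addr0.
by exists v => //; exists (fun=> 0); rewrite big_set0 addr0.
Qed.

(** Enlarging the conditioning set is one step of the abstract Schur
    decomposition, with the direct sum of the new coefficient spaces as the
    added space; [residual_step] below is applied through this lemma and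
    through [trial_block]. *)
Lemma trial_setU A S x : [disjoint A & S]%B ->
  trialS (A :|: S) x <->
  exists z (e : joint_space E A), trialS S z /\ x = z + joint_block (A := A) C e.
Proof.
move=> dAS; split=> [[v hv [e ->]]|[_ [e [[v hv [f ->]] ->]]]].
  exists (v + \sum_(p in S) C p (e p)), [ffun p => e (val p)]; split.
    by exists v => //; exists e.
  rewrite sum_setU_disjoint // -addrA; congr (_ + _).
  rewrite addrC; congr (_ + _); rewrite big_sub.
  by apply: eq_bigr => p _; rewrite ffunE.
apply: linsubspaceD; first exact: trial_linsubspace.
- exists v => //; exists (fun p => if p \in S then f p else 0); congr (_ + _).
  rewrite sum_setU_disjoint // [X in _ = X + _]big1 ?add0r.
    by apply: eq_bigr => p ->.
  move=> p pA; rewrite (disjointFr dAS pA); exact: (lin0 (linC p)).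
- apply: linsubspace_sum => [|p _]; first exact: trial_linsubspace.
  exists 0; first by case: fV0 => -[].
  exists (@dfwith Q E (fun=> 0) (val p) (e p)); rewrite add0r (bigD1 (val p)) /=; last first.
    by rewrite inE (valP p).
  rewrite dfwithin big1 ?addr0 // => q /andP[_ qp].
  rewrite dfwithout 1?eq_sym //; exact: (lin0 (linC q)).
Qed.

Lemma image_trial_linsubspace S : linsubspace (Zs S).
Proof. by case: (image_trial_findim S). Qed.

Lemma proj_mem S y : Zs S (proj S y).
Proof. by case: (orth_projP iY y (image_trial_findim S)). Qed.

Lemma proj_orth S y w : Zs S w -> ipY (y - proj S y) w = 0.
Proof. by case: (orth_projP iY y (image_trial_findim S)) => _; apply. Qed.

(** Best approximation, by Pythagoras. *)
Lemma residual_least S z : Zs S z -> rn S <= rdot ipY (g - z) (g - z).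
Proof.
move=> Zz; have -> : g - z = rsd S + (proj S g - z) by rewrite addrA subrK.
have h0 : ipY (rsd S) (proj S g - z) = 0.
  apply: proj_orth; apply: (linsubspaceB (image_trial_linsubspace S)) => //.
  exact: proj_mem.
by rewrite (pythagoras iY h0) lerDl rdot_ge0.
Qed.

Lemma min_residualE S : min_residual ipY T g V0 C S = rn S.
Proof.
have [x hx hTx] := proj_mem S g.
rewrite /min_residual; apply/le_anti/andP; split.
  apply: ge_inf; last by exists x => //; rewrite hTx hnorm_sqr.
  by exists 0 => _ [v _ <-]; exact: sqr_ge0.
apply: lb_le_inf; first by exists (hnorm ipY (g - T x) ^+ 2), x.
by move=> _ [v hv <-]; rewrite hnorm_sqr //; apply: residual_least; exists v.
Qed.

(** A minimizer realizes the projection in [Y], even though it need not be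
    unique in [X]. *)
Lemma minimizer_residual S u : minimizer ipY T g (trialS S) u -> g - T u = rsd S.
Proof.
move=> [hu hmin]; congr (_ - _); apply: subr0_eq; apply: (rdot_eq0 iY).
have [x hx hTx] := proj_mem S g.
have := hmin _ hx; rewrite -(@ler_pXn2r _ 2) ?nnegrE ?hnorm_ge0 //.
rewrite !hnorm_sqr // hTx.
have -> : g - T u = rsd S + (proj S g - T u) by rewrite addrA subrK.
have h0 : ipY (rsd S) (proj S g - T u) = 0.
  apply: proj_orth; apply: (linsubspaceB (image_trial_linsubspace S)); first exact: proj_mem.
  by exists u.
rewrite (pythagoras iY h0) gerDl => h.
rewrite -opprB rdotNl // rdotNr // opprK.
by apply/le_anti; rewrite h rdot_ge0.
Qed.

Section SchurStep.
Variables (F : lmodType K) (ipF : F -> F -> K) (iF : is_inner ipF).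
Hypothesis fF : findim_subspace [set: F].
Variables (L : F -> X) (linL : linear L) (S S' : {set Q}).
Hypothesis trialS' : forall x,
  trialS S' x <-> exists z (e : F), trialS S z /\ x = z + L e.

Local Notation Qm := (schur ipY T V0 C L S).

Lemma schur_linear : linear Qm.
Proof.
move=> a x y; rewrite /schur linL linT (orth_proj_linear iY (image_trial_findim S)).
by rewrite opprD addrACA -scalerBr.
Qed.

Lemma schur_orth e w : Zs S w -> ipY (Qm e) w = 0.
Proof. exact: proj_orth. Qed.

(** The added space contributes exactly the range of [Q], the part of
    [T L e] orthogonal to the old space; a best approximation of the old
    residual there is all that is missing from the new projection. *)
Lemma residual_step e : (forall f, ipY (rsd S - Qm e) (Qm f) = 0) ->
  rsd S' = rsd S - Qm e /\ rn S' = rn S - rdot ipY (Qm e) (Qm e).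
Proof.
move=> he.
have rS' : rsd S' = rsd S - Qm e.
  have -> : rsd S - Qm e = g - (proj S g + Qm e) by rewrite [in RHS]opprD [RHS]addrA.
  congr (_ - _); apply: (orth_proj_uniq iY (image_trial_findim S')).
    have /linsubspaceB h := image_trial_linsubspace S.
    have [z hz hTz] := h _ _ (proj_mem S g) (proj_mem S (T (L e))).
    exists (z + L e); first by apply/trialS'; exists z, e.
    by rewrite (linD linT) hTz /schur addrAC addrA.
  move=> _ [_ /trialS' [z [f [hz ->]]] <-].
  have -> : g - (proj S g + Qm e) = rsd S - Qm e by rewrite [in LHS]opprD [LHS]addrA.
  have o w : Zs S w -> ipY (rsd S - Qm e) w = 0.
    by move=> hw; rewrite ipBl // proj_orth // schur_orth // subrr.
  have -> : T (z + L f) = Qm f + (proj S (T (L f)) + T z).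
    by rewrite (linD linT) /schur addrA subrK addrC.
  by rewrite ipDr // he add0r ipDr // (o _ (proj_mem _ _)) add0r o //; exists z.
split=> //; rewrite rS'.
have h0 : ipY (rsd S - Qm e) (Qm e) = 0 by exact: he.
have := pythagoras iY h0; rewrite subrK => ->; by rewrite addrK.
Qed.

Local Notation D := (schur_gram ipY T V0 C ipF L S).
Local Notation b := (adjoint ipF ipY Qm (rsd S)).

(** The normal equations [D x = Q^* r] say that [Q x] is the projection of
    the residual [r] onto the range of [Q]. The solution [x] is taken in the
    quotient, where the lower spectral bound applies. *)
Lemma residual_gram :
  exists2 x, coker ipF Qm x & [/\ x = pseudoinverse ipF D b,
    D x = b,
    rn S - rn S' = rdot ipY (Qm x) (Qm x) &
    rdot ipY (Qm x) (Qm x) = rdot ipY (Qm x) (rsd S)].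
Proof.
have lQ := schur_linear.
have [Wx Dx] := gram_pseudoinverse iF iY fF lQ (adjoint_coker iF iY fF lQ (rsd S)).
exists (pseudoinverse ipF D b) => //; move: Wx Dx; rewrite -/D.
set x := pseudoinverse _ _ _ => Wx Dx.
have o f : ipY (rsd S - Qm x) (Qm f) = 0.
  apply: (ip_eq0C iY); rewrite ipBr // !(adjointP iF iY fF lQ).
  have Dx' : adjoint ipF ipY Qm (Qm x) = b := Dx.
  by rewrite Dx' subrr.
have [_ ->] := residual_step o; split => //; first by rewrite subKr.
rewrite [RHS]rdotC //; have := o x; rewrite ipBl // => /subr0_eq h.
by rewrite /rdot h.
Qed.

(** As [D x = b] with [x] the pseudoinverse applied to [b], the dagger gain is
    [<D x, x> = |Q x|^2]. *)
Lemma gain_dagger : rn S - rn S' = dagger_gain ipF D b.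
Proof.
have [x _ [xE Dx -> _]] := residual_gram.
rewrite /dagger_gain -xE -/(rdot ipF _ _) -Dx.
by rewrite (rdot_gram iF iY fF schur_linear).
Qed.

(** The variational bound: [|r|^2 - |r - Q f|^2] is a gain realized by the
    trial direction [f], hence at most the optimal gain. *)
Lemma gain_ge f : 2 * rdot ipY (Qm f) (rsd S) - rdot ipY (Qm f) (Qm f) <= rn S - rn S'.
Proof.
have /linsubspaceB h := image_trial_linsubspace S.
have [z hz hTz] := h _ _ (proj_mem S g) (proj_mem S (T (L f))).
have : Zs S' (T (z + L f)) by exists (z + L f) => //; apply/trialS'; exists z, f.
move/residual_least.
have -> : g - T (z + L f) = rsd S - Qm f.
  have -> : T (z + L f) = proj S g + Qm f by rewrite (linD linT) hTz /schur addrAC addrA.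
  by rewrite [in LHS]opprD [LHS]addrA.
move: (rn S') (rsd S) (Qm f) => c r w.
rewrite rdotBl // !rdotBr // (rdotC iY r w); lra.
Qed.

Lemma schur_gramE e : rdot ipF (D e) e = rdot ipY (Qm e) (Qm e).
Proof. exact: (rdot_gram iF iY fF schur_linear). Qed.

End SchurStep.

Lemma trial_block S p x : p \notin S -> trialS (p |: S) x <->
  exists z (e : E p), trialS S z /\ x = z + C p e.
Proof.
move=> pS; split=> [[v hv [e ->]]|[_ [f [[v hv [e ->]] ->]]]].
  exists (v + \sum_(q in S) C q (e q)), (e p); split; first by exists v => //; exists e.
  by rewrite big_setU1 //= -addrA [X in _ + X = _]addrC.
exists v => //; exists (@dfwith Q E e p f).
rewrite big_setU1 //= dfwithin -addrA [X in _ + X = _]addrC.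
congr (_ + (_ + _)); apply: eq_bigr => q qS.
by rewrite dfwithout //; apply: contraNneq pS => ->.
Qed.

Lemma joint_block_linear A : linear (joint_block (A := A) C).
Proof.
move=> a x y; rewrite /joint_block scaler_sumr -big_split; apply: eq_bigr => p _.
by rewrite !ffunE linC.
Qed.

Lemma joint_inner_is_inner A : is_inner (joint_inner (A := A) ipE).
Proof. by apply: dsum_is_inner => p; exact: iE. Qed.

Lemma joint_space_findim A : findim_subspace [set: joint_space E A].
Proof. by apply: dsum_findim => p; exact: fE. Qed.

Lemma schur_joint A S (e : joint_space E A) :
  schur ipY T V0 C (joint_block (A := A) C) S e =
  \sum_(p : {p | p \in A}) schur ipY T V0 C (C (val p)) S (e p).
Proof.
rewrite /schur /joint_block (lin_sum linT).
by rewrite (lin_sum (orth_proj_linear iY (image_trial_findim S))) -sumrB.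
Qed.

Lemma joint_inner_rdot A (e : joint_space E A) :
  rdot (joint_inner (A := A) ipE) e e =
  \sum_(p : {p | p \in A}) rdot (ipE (val p)) (e p) (e p).
Proof.
by rewrite /rdot /joint_inner /dsum_inner (big_morph _ (@reKD R cplx) (reK0 R cplx)).
Qed.

Lemma residual_antitone S S' : S \subset S' -> rn S' <= rn S.
Proof.
move=> sSS'; have dis : [disjoint S' :\: S & S]%B.
  by rewrite -setI_eq0 finset.setIDAC finset.setDIl finset.setDv finset.setI0.
have [z hz <-] := proj_mem S g.
have : Zs S' (T z); last exact: residual_least.
exists z => //; rewrite -(finset.setID S' S) (finset.setIidPr sSS') finset.setUC.
apply/trial_setU => //.
exists z, 0; split => //.
by rewrite (lin0 (joint_block_linear (A := S' :\: S))) addr0.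
Qed.

(** A single block that is not redundant gives a nonzero vector of the
    quotient, on which both spectral bounds hold. *)
Lemma block_bounds_le S p e (a B : R) : schur ipY T V0 C (C p) S e <> 0 ->
  quotient_ge (joint_inner (A := [set p]) ipE)
         (schur ipY T V0 C (joint_block (A := [set p]) C) S)
         (schur_gram ipY T V0 C (joint_inner (A := [set p]) ipE)
            (joint_block (A := [set p]) C) S) a ->
  operator_le (ipE p) (schur_gram ipY T V0 C (ipE p) (C p) S) B ->
  a <= B.
Proof.
move=> Qe0 hl hu.
have p0 : p \in [set p]%SET by rewrite inE.
pose i0 : {q | q \in [set p]%SET} := exist _ p p0.
have one (V : nmodType) (f : {q | q \in [set p]%SET} -> V) : \sum_i f i = f i0.
  rewrite (big_pred1 i0) // => i /=; apply/esym/eqP/val_inj => /=.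
  by have := valP i; rewrite inE => /eqP.
have iJ := joint_inner_is_inner [set p]%SET.
have fJ := joint_space_findim [set p]%SET.
have lJ : linear (joint_block (A := [set p]%SET) C) := joint_block_linear (A := [set p]%SET).
have lQ := @schur_linear _ _ lJ S.
have QE (w : joint_space E [set p]%SET) :
    schur ipY T V0 C (joint_block (A := [set p]%SET) C) S w = schur ipY T V0 C (C p) S (w i0).
  by rewrite schur_joint one.
have [w Ww] := coker_split iJ fJ lQ (dsum_inj (e : E (val i0))).
rewrite (linB lQ) => /eqP; rewrite subr_eq0 !QE ffunE dfwithin => /eqP eQ.
have := hl w Ww; rewrite -!/(rdot _ _ _) (schur_gramE iJ fJ lJ) joint_inner_rdot one QE.
have := hu (w i0); rewrite -!/(rdot _ _ _) (schur_gramE (iE p) (fE p) (linC p)).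
move=> h1 h2; have := le_trans h2 h1; rewrite ler_pM2r //.
apply: (ip_gt0 (iE p)); apply/eqP => w0; apply: Qe0.
by rewrite eQ w0; exact: (lin0 (@schur_linear _ (C p) (linC p) S)).
Qed.

(** Weak submodularity. Let [e] in the quotient of the joint space realize
    the joint gain [h = |Q e|^2 = <Q e, r>], so that [a |e|^2 <= h]. By
    [gain_ge] the trial direction [t e_p] gives each block [p] a gain of at
    least [2 t <Q_p e_p, r> - t^2 B |e_p|^2]. The sum over the blocks is at
    least [2 t h - t^2 B h / a], which is [(a / B) h] at the optimal
    [t = a / B]. *)
Lemma joint_gain_le A S (a B : R) : [disjoint A & S]%B -> 0 < a -> 0 < B ->
  quotient_ge (joint_inner (A := A) ipE)
         (schur ipY T V0 C (joint_block (A := A) C) S)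
         (schur_gram ipY T V0 C (joint_inner (A := A) ipE)
            (joint_block (A := A) C) S) a ->
  (forall p, p \in A -> operator_le (ipE p) (schur_gram ipY T V0 C (ipE p) (C p) S) B) ->
  a / B * (rn S - rn (A :|: S)) <= \sum_(p in A) (rn S - rn (p |: S)).
Proof.
move=> dAS a0 B0 hl hu.
have [e We [_ _ -> hQ]] := residual_gram (joint_inner_is_inner A)
  (joint_space_findim A) (joint_block_linear (A := A)) (fun x => trial_setU x dAS).
set h := rdot ipY _ _ in hQ *.
have hle : a * rdot (joint_inner (A := A) ipE) e e <= h.
  rewrite /h -(schur_gramE (joint_inner_is_inner A) (joint_space_findim A)
    (joint_block_linear (A := A))).
  exact: hl.
(* The maximizer of 2 t h - t^2 B h / a. *)
pose t := a / B.
have t0 : 0 < t by rewrite divr_gt0.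
have step (p : {p | p \in A}) :
   2 * (t * rdot ipY (schur ipY T V0 C (C (val p)) S (e p)) (rsd S))
    - t ^+ 2 * B * rdot (ipE (val p)) (e p) (e p) <= rn S - rn (val p |: S).
  have pS : val p \notin S by rewrite (disjointFr dAS (valP p)).
  have := gain_ge (fun x => trial_block x pS) (ofR cplx t *: e p).
  rewrite (linZ (@schur_linear _ (C (val p)) (linC (val p)) S)) !rdotZl // rdotZr //.
  have := hu _ (valP p) (e p); rewrite -!/(rdot _ _ _).
  rewrite (schur_gramE (iE (val p)) (fE (val p)) (linC (val p))) => hp.
  apply: le_trans; rewrite lerD2l lerN2 mulrA -expr2 -mulrA ler_pM2l ?exprn_gt0 //.
rewrite big_sub; apply: le_trans (ler_sum _ (fun p _ => step p)).
rewrite big_split /= sumrN -!mulr_sumr -joint_inner_rdot.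
have -> : \sum_(p : {p | p \in A})
    rdot ipY (schur ipY T V0 C (C (val p)) S (e p)) (rsd S) = h.
  rewrite hQ schur_joint /rdot.
  by rewrite (big_morph (fun y => reK (ipY y (rsd S)))
    (fun y z => rdotDl iY y z (rsd S)) (rdot0l iY (rsd S))).
rewrite -/t.
have : t * (a * rdot (joint_inner (A := A) ipE) e e) <= t * h by rewrite ler_pM2l.
have -> : t ^+ 2 * B = t * a by rewrite /t; field; rewrite gt_eqF.
lra.
Qed.

End Blocks.

(** * The greedy recursion and the performance guarantee *)

Local Close Scope classical_set_scope.

(** Unrolling the one-step contraction of the defect [c - a m]: the error made
    at step [j] is damped by [rho] in each later step. *)
Lemma greedy_recursion (R : realFieldType) (rho c : R) (a delta : nat -> R) (n : nat) :
  0 <= rho -> a 0%N = 0 ->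
  (forall m, (m < n)%N -> rho * a m + (1 - rho) * c - delta m <= a m.+1) ->
  forall m, (m <= n)%N ->
  (1 - rho ^+ m) * c - \sum_(j < m) rho ^+ (m - 1 - j) * delta j <= a m.
Proof.
move=> rho0 a0 step; elim=> [|m ih] mn.
  by rewrite big_ord0 expr0 subrr mul0r subr0 a0.
apply: le_trans (step m mn).
rewrite big_ord_recr /= subSS subn0 subnn expr0 mul1r.
have -> : \sum_(j < m) rho ^+ (m - j) * delta j =
    rho * \sum_(j < m) rho ^+ (m - 1 - j) * delta j.
  rewrite mulr_sumr; apply: eq_bigr => j _; rewrite mulrA -exprS.
  by congr (_ ^+ _ * _); rewrite subnAC subn1 prednK // subn_gt0.
have := ler_wpM2l rho0 (ih (ltnW mn)); rewrite exprS; lra.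
Qed.

Theorem theorem3p7 (R : realType) (cplx : bool)
    (X Y : completeNormedModType (scalarK R cplx))
    (ipX : {inner X}) (hX : forall x : X, `|x| ^+ 2 = ipX x x)
    (ipY : {inner Y}) (hY : forall y : Y, `|y| ^+ 2 = ipY y y)
    (T : {linear X -> Y}) (hT : bounded_near T (nbhs (0 : X)))
    (g : Y)
    (V0 : set X) (hV0 : finite_dim_subspace V0)
    (u0 : X) (hu0 : minimizer ipY T g V0 u0)
    (Q : finType) (E : Q -> vectType (scalarK R cplx))
    (ipE : forall p, {inner (E p)})
    (C : forall p, {linear E p -> X})
    (k : nat) (hk : (1 <= k)%N)
    (A2k B1 : R) (hA2k : 0 < A2k)
    (hlower : forall A S : {set Q}, [disjoint A & S] ->
       (#|A :|: S| <= 2 * k)%N ->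
       quotient_ge (joint_inner (A := A) ipE)
         (schur ipY T V0 C (joint_block (A := A) C) S)
         (schur_gram ipY T V0 C (joint_inner (A := A) ipE)
            (joint_block (A := A) C) S)
         A2k)
    (n : nat) (hn : (n <= k)%N)
    (q : 'I_n -> Q) (S : nat -> {set Q})
    (u : nat -> X)
    (Dt : nat -> forall p, {linear E p -> E p})
    (bt : nat -> forall p, E p)
    (AC epsD epsb : nat -> Q -> R)
    (hS0 : S 0%N = finset.set0)
    (hS : forall m : 'I_n, S m.+1 = q m |: S m)
    (hu : forall m, (m <= n)%N -> minimizer ipY T g (trial V0 C (S m)) (u m))
    (hupper : forall m, (m <= n)%N -> (m < k)%N -> forall p, p \notin S m ->
       operator_le (ipE p) (schur_gram ipY T V0 C (ipE p) (C p) (S m)) B1)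
    (hgreedy : forall m : 'I_n, q m \notin S m /\
       forall p, p \notin S m ->
         dagger_gain (ipE p) (Dt m p) (bt m p)
         <= dagger_gain (ipE (q m)) (Dt m (q m)) (bt m (q m)))
    (* gamma <= 1 is proved below, except in the degenerate case where every
       block is exactly redundant and the spectral bounds are vacuous *)
    (hredundant :
       (forall p e, schur ipY T V0 C (C p) finset.set0 e = 0) -> A2k <= B1) :
  let F := residual_drop ipY T g V0 C u0 in
  let minres := min_residual ipY T g V0 C in
  let gain m p := F (p |: S m) - F (S m) in
  let Qs m p := schur ipY T V0 C (C p) (S m) in
  let D m p := schur_gram ipY T V0 C (ipE p) (C p) (S m) in
  let b m p := adjoint (ipE p) ipY (Qs m p) (g - T (u m)) in
  let Gt m p := dagger_gain (ipE p) (Dt m p) (bt m p) in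
  let Xi m p := margin (ipE p) (bt m p) (AC m p) (epsD m p) (epsb m p) in
  let gamma : R := A2k / B1 in
  let delta m : R := 2 * \big[Num.max/0]_(p | p \notin S m) Xi m p in
  let rho : R := 1 - gamma / k%:R in
  [/\ gamma <= 1,
      forall m p, (m < n)%N -> p \notin S m ->
        gain m p = dagger_gain (ipE p) (D m p) (b m p) /\
        (ranking_hypotheses (ipE p) (Qs m p) (D m p) (b m p)
           (Dt m p) (bt m p) (AC m p) (epsD m p) (epsb m p) ->
         `|gain m p - Gt m p| <= Xi m p) &
      (forall m p, (m < n)%N -> p \notin S m ->
         `|gain m p - Gt m p| <= Xi m p) ->
      [/\ forall (m : nat) (O : {set Q}), (m <= n)%N -> (#|O| <= k)%N ->
            F (S m) >= (1 - rho ^+ m) * F O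
                       - \sum_(j < m) rho ^+ (m - 1 - j) * delta j,
          n = k -> forall O : {set Q}, (#|O| <= k)%N ->
            F (S k) >= (1 - expR (- gamma)) * F O
                       - \sum_(j < k) rho ^+ (k - 1 - j) * delta j &
          n = k -> forall O : {set Q}, (#|O| <= k)%N ->
            minres (S k) <= minres O + expR (- gamma) * F O
                            + \sum_(j < k) rho ^+ (k - 1 - j) * delta j]].
Proof.
move=> F minres gain Qs D b Gt Xi gamma delta rho.
have iY := inner_is_inner ipY.
have iE p : is_inner (ipE p) := inner_is_inner (ipE p).
have fE p : findim_subspace [set: E p] := vectType_findim (E p).
have linT : linear T by move=> a x y; exact: linearP.
have linC p : linear (C p) by move=> a x y; exact: linearP.
have fV0 := finite_dim_subspace_findim hV0.
have k0 : 0 < k%:R :> R by rewrite ltr0n.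
pose rs A := g - orth_proj ipY (T @` trial V0 C A)%classic g.
pose rn A := rdot ipY (rs A) (rs A).
have minresE A : minres A = rn A := min_residualE iY linT g fV0 fE linC A.
have rn0 : hnorm ipY (g - T u0) ^+ 2 = rn finset.set0.
  rewrite hnorm_sqr //; congr (rdot ipY _ _);
  apply: (minimizer_residual iY linT fV0 fE linC); by rewrite trial_set0.
have FE A : F A = rn finset.set0 - rn A.
  by rewrite /F /residual_drop rn0 [min_residual _ _ _ _ _ _]minresE.
have gainE m p : gain m p = rn (S m) - rn (p |: S m) by rewrite /gain !FE; ring.
have rn_anti (A A' : {set Q}) : A \subset A' -> rn A' <= rn A.
  exact: (residual_antitone iY linT g fV0 fE linC).
have F_mono (A A' : {set Q}) : A \subset A' -> F A <= F A'.
  by move=> /rn_anti; rewrite !FE lerD2l lerN2.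
have F_ge0 A : 0 <= F A by rewrite FE subr_ge0; apply: rn_anti; exact: finset.sub0set.
(* With 0 < A2k this also makes B1 positive. *)
have AB : A2k <= B1.
  have [|/existsNP[p /existsNP[e he]]] :=
    pselect (forall p e, schur ipY T V0 C (C p) finset.set0 e = 0); first exact: hredundant.
  apply: (block_bounds_le iY linT fV0 iE fE linC he).
  - apply: hlower; first by rewrite -setI_eq0 finset.setI0.
    by rewrite finset.setU0 cards1 (leq_trans hk) // leq_pmull.
  - by have := @hupper 0%N isT hk p; rewrite hS0 inE; apply.
have B0 : 0 < B1 := lt_le_trans hA2k AB.
have gamma1 : gamma <= 1 by rewrite ler_pdivrMr // mul1r.
have gamma0 : 0 < gamma by rewrite divr_gt0.
have rsE m : (m <= n)%N -> g - T (u m) = rs (S m).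
  move=> mn; have h := minimizer_residual iY linT fV0 fE linC (hu m mn). exact: h.
split=> //.
  move=> m p mn pS; have gE : gain m p = dagger_gain (ipE p) (D m p) (b m p).
    rewrite gainE /b rsE 1?ltnW //.
    apply: (gain_dagger iY linT g fV0 fE linC (iE p) (fE p) (linC p)) => x.
    exact: trial_block.
  split => // hr; rewrite gE.
  have lQ : linear (Qs m p) :=
    @schur_linear _ _ _ _ _ iY _ linT _ fV0 _ _ fE _ linC _ _ (linC p) (S m).
  apply: (ranking_estimate (iE p) iY (fE p) lQ _ _ hr).
    by move=> a x y; exact: linearP.
  exact: adjoint_coker.
move=> hXi.
have cardS m : (m <= n)%N -> (#|S m| <= m)%N.
  elim: m => [|m ih] mn; first by rewrite hS0 cards0.
  have -> := hS (Ordinal mn).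
  by rewrite cardsU1 -[m.+1]add1n leq_add ?leq_b1 // ih // ltnW.
have step (O : {set Q}) m : (#|O| <= k)%N -> (m < n)%N ->
    rho * F (S m) + (1 - rho) * F O - delta m <= F (S m.+1).
  move=> Ok mn; pose A := O :\: S m.
  have dAS : [disjoint A & S m].
    by rewrite -setI_eq0 finset.setIDAC finset.setDIl finset.setDv finset.setI0.
  have AU : A :|: S m = O :|: S m.
    by apply/setP => p; rewrite !inE; case: (p \in S m); rewrite ?orbT ?orbF.
  have Ak : (#|A| <= k)%N by rewrite (leq_trans _ Ok) // subset_leq_card // finset.subsetDl.
  have mk : (m < k)%N := leq_trans mn hn.
  have hj : gamma * (rn (S m) - rn (A :|: S m)) <= \sum_(p in A) (rn (S m) - rn (p |: S m)).
    apply: (joint_gain_le iY linT g fV0 iE fE linC dAS hA2k B0).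
      apply: hlower => //; rewrite (leq_trans (leq_card_setU _ _)) // mul2n -addnn leq_add //.
      by rewrite (leq_trans (cardS _ (ltnW mn))) // ltnW.
    move=> p pA; apply: hupper => //; first exact: ltnW.
    by rewrite (disjointFr dAS pA).
  have [qS qmax] := hgreedy (Ordinal mn); rewrite /= in qS qmax.
  set qm := q (Ordinal mn) in qS qmax.
  have SS : S m.+1 = qm |: S m := hS (Ordinal mn).
  have Xile p : p \notin S m -> Xi m p <= \big[Num.max/0]_(p | p \notin S m) Xi m p.
    by move=> pS; apply: le_bigmax_cond.
  (* Greedy choice with two ranking errors, one for p and one for q m. *)
  have hgain p : p \notin S m -> gain m p <= gain m qm + delta m.
    move=> pS; have := hXi _ _ mn pS; have := hXi _ _ mn qS.
    have := qmax _ pS; have := Xile _ pS; have := Xile _ qS.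
    rewrite -!/(Gt _ _) /delta !ler_norml => ? ? ? /andP[? ?] /andP[? ?].
    lra.
  have gq0 : 0 <= gain m qm + delta m.
    by apply: le_trans (hgain _ qS); rewrite gainE subr_ge0 rn_anti // finset.subsetUr.
  have hs : \sum_(p in A) (rn (S m) - rn (p |: S m)) <= k%:R * (gain m qm + delta m).
    apply: (@le_trans _ _ (\sum_(p in A) (gain m qm + delta m))).
      by apply: ler_sum => p pA; rewrite -gainE hgain // (disjointFr dAS pA).
    by rewrite sumr_const -[leLHS]mulr_natl ler_wpM2r // ler_nat.
  have hF : F O - F (S m) <= rn (S m) - rn (A :|: S m).
    have := F_mono O (A :|: S m); rewrite AU finset.subsetUl => /(_ isT); rewrite !FE; lra.
  have h1 : gamma * (F O - F (S m)) <= k%:R * (gain m qm + delta m).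
    by apply: le_trans (le_trans hj hs); rewrite ler_pM2l.
  have h2 : gamma / k%:R * (F O - F (S m)) <= gain m qm + delta m.
    by rewrite mulrAC ler_pdivrMr // mulrC [leRHS]mulrC mulrC.
  have : gain m qm = F (S m.+1) - F (S m) by rewrite /gain SS.
  move: h2; rewrite /rho; lra.
have rho0 : 0 <= rho.
  by rewrite subr_ge0 ler_pdivrMr // mul1r (le_trans gamma1) // ler1n.
have main m (O : {set Q}) : (m <= n)%N -> (#|O| <= k)%N ->
    (1 - rho ^+ m) * F O - \sum_(j < m) rho ^+ (m - 1 - j) * delta j <= F (S m).
  move=> mn Ok; apply: (greedy_recursion (n := n) (a := fun m => F (S m))) => //.
    by rewrite hS0 FE subrr.
  by move=> j; exact: step.
have rhok : rho ^+ k <= expR (- gamma).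
  have -> : - gamma = k%:R * (- (gamma / k%:R)) by field; rewrite gt_eqF.
  rewrite expRM_natl lerXn2r ?nnegrE ?expR_ge0 //.
  exact: expR_ge1Dx.
have main' (O : {set Q}) : n = k -> (#|O| <= k)%N ->
    (1 - expR (- gamma)) * F O - \sum_(j < k) rho ^+ (k - 1 - j) * delta j <= F (S k).
  move=> nk Ok; apply: le_trans (main k O _ Ok); last by rewrite nk.
  by rewrite lerD2r ler_wpM2r // lerD2l lerN2.
split => [m O mn Ok|nk O Ok|nk O Ok]; [exact: main|exact: main'|].
have := main' O nk Ok; rewrite !minresE; move: (\sum_(j < k) _) => s.
rewrite !FE; lra.
Qed.
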